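(* Let $0<\beta_1\le\beta_2<\beta_3\le 1$ be constants, let $(p_n)_{n\ge 3}$ be a sequence in $(0,1)$, and for each $n\ge 3$ let $G$ be the inhomogeneous Erdős–Rényi random graph on $\{1,\dots,n\}$ with edge probabilities $p(i,j)$ (which may depend on $n$). Assume that for all $n$ large $$\inf_{1\le i\le n}\frac{1}{n-1}\sum_{j\ne i}p(i,j)\ \ge\ \beta_3 p_n$$ and $$\inf_{1\le i\le n}\ \inf_{S}\ \frac{1}{\#S}\sum_{j\in S}p(i,j)\ \ge\ \beta_1 p_n,$$ where, for fixed $i$, the inner infimum is over all sets $S\subseteq\{1,\dots,n\}$ with $i\notin S$ and $\#S\ge\beta_2 np_n$. Suppose moreover that $$p_n\longrightarrow 0\quad\text{and}\quad \frac{\log n}{np_n}\longrightarrow 0\qquad\text{as } n\to\infty .$$ Let $L_n$ denote the length (number of vertices) of the longest path in $G$. Then: (i) $\mathbb{E}L_n\ \ge\ n-2n e^{-\beta_1\beta_2 np_n^2}$ for all $n$ large. (ii) For any $0<\delta<1$, $$\mathbb{P}\left(L_n\ge n-2n\exp\left(-\beta_1\beta_2(1-\delta)np_n^2\right)\right)\ \ge\ 1-\exp\left(-\beta_1\beta_2\delta np_n^2\right)$$ for all $n$ large. (iii) Suppose in addition that $np_n^2=M\log n$ for all $n$ large, for some constant $M>(\beta_1\beta_2)^{-1}$, and set $M_1=M\beta_1\beta_2>1$. Then $$\mathbb{E}L_n\ \ge\ n-\frac{2}{n^{M_1-1}}\qquad\text{and}\qquad \mathbb{P}(L_n=n)\ \ge\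 1-\frac{2}{n^{M_1-1}}$$ for all $n$ large.
   Context: Inhomogeneous Erdős–Rényi random graph: for $n\ge3$, the vertex set is $\{1,\dots,n\}$, and for each unordered pair of distinct vertices $\{i,j\}$ the edge between $i$ and $j$ is present (open) with probability $p(i,j)=p(j,i)\in[0,1]$ and absent (closed) otherwise, independently over all pairs. $\#S$ denotes the cardinality of a set $S$. All the constants $\beta_1,\beta_2,\beta_3$ are independent of $n$. A path is a simple path (distinct vertices, consecutive ones adjacent), and its length $L$ is measured as its number of vertices, so that $L_n=n$ means that $G$ contains a Hamiltonian path. ''For all $n$ large'' means for all $n\ge n_0$ for some $n_0$ (which may depend on the constants and sequences involved). *)

(* Defs.v *)
From HB Require Import structures.
From mathcomp Require Import all_boot all_order all_algebra.
From mathcomp Require Import all_classical all_reals all_analysis.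

Set Implicit Arguments.
Unset Strict Implicit.
Unset Printing Implicit Defensive.

Import Order.TTheory GRing.Theory Num.Theory.
Import numFieldNormedType.Exports.

Local Open Scope classical_set_scope.
Local Open Scope ring_scope.

(* A simple path is a duplicate-free sequence of vertices whose consecutive
   members are adjacent. *)
Definition simple_path (V : finType) (e : rel V) (s : seq V) : bool :=
  uniq s && sorted e s.

(* The length of a path is its number of vertices; it is at most #|V|.  The
   empty sequence (k = 0) does not affect the maximum. *)
Definition longest_path (V : finType) (e : rel V) : nat :=
  \max_(k < #|V|.+1 | [exists s : k.-tuple V, simple_path e s]) k.

Definition mutually_independent (R : realType) (d : measure_display)
    (T : measurableType d) (P : probability T R) (I : finType) (D : {set I})
    (E : I -> set T) : Prop :=
  forall B : {set I}, B \subset D ->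
    P (\bigcap_(i in [set` B]) E i) = (\prod_(i in B) P (E i))%E.

(* The unordered pairs of distinct vertices, each one represented by its
   increasing ordering. *)
Definition vertex_pairs (n : nat) : {set 'I_n * 'I_n} :=
  [set ij : 'I_n * 'I_n | (ij.1 < ij.2)%N]%SET.

Definition edge_event (T : Type) (n : nat) (G : T -> rel 'I_n)
    (ij : 'I_n * 'I_n) : set T :=
  [set w | G w ij.1 ij.2].

(* The vertices 1, ..., n are represented by the elements 0, ..., n - 1 of
   'I_n. *)
Record inhomogeneous_ER (R : realType) (d : measure_display)
    (T : measurableType d) (P : probability T R) (n : nat)
    (p : 'I_n -> 'I_n -> R) (G : T -> rel 'I_n) : Prop := InhomogeneousER {
  ER_sym : forall w, symmetric (G w);
  ER_irrefl : forall w, irreflexive (G w);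
  ER_measurable : forall ij, ij \in vertex_pairs n ->
    measurable (edge_event G ij);
  ER_prob : forall ij, ij \in vertex_pairs n ->
    P (edge_event G ij) = (p ij.1 ij.2)%:E;
  ER_indep : mutually_independent P (vertex_pairs n) (edge_event G)
}.

Definition path_length (R : realType) (T : Type) (n : nat)
    (G : T -> rel 'I_n) : T -> R :=
  fun w => (longest_path (G w))%:R.

(* The infima below are taken in the extended reals, so that the infimum over
   an empty family is +oo. *)
Definition inf_mean_prob (R : realType) (n : nat) (p : 'I_n -> 'I_n -> R)
    : \bar R :=
  ereal_inf [set ((n%:R - 1)^-1 * \sum_(j | j != i) p i j)%:E
            | i in [set: 'I_n]].

Definition inf_local_mean_prob (R : realType) (n : nat)
    (p : 'I_n -> 'I_n -> R) (m : R) : \bar R :=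
  ereal_inf [set
    ereal_inf [set ((#|S|%:R)^-1 * \sum_(j in S) p i j)%:E
              | S in [set S : {set 'I_n} | i \notin S /\ m <= #|S|%:R]]
  | i in [set: 'I_n]].

(* Main.v *)
Require Import Defs.
From HB Require Import structures.
From mathcomp Require Import all_boot all_order all_algebra.
From mathcomp Require Import all_classical all_reals all_analysis.
From mathcomp Require Import measurable_realfun ring lra.

Set Implicit Arguments.
Unset Strict Implicit.
Unset Printing Implicit Defensive.

Import Order.TTheory GRing.Theory Num.Theory.
Import numFieldNormedType.Exports.

Local Open Scope classical_set_scope.
Local Open Scope ring_scope.

(** Everything follows from a bound on the expected number of vertices missed
by a longest path, [E (n - L_n) <= 2 n exp (- x)] with
[x = beta1 * beta2 * n * p_n ^ 2]: part (i) is this bound, and parts (ii) and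
(iii) are Markov's inequality applied to the integer [n - L_n].

Call a vertex [v] omittable if some longest path avoids it.  All the vertices
outside one longest path are omittable, so [n - L_n] is at most the number of
omittable vertices ([deficit_le_omittable]), and it suffices to show that each
vertex [v] is omittable with probability at most [2 exp (- x)].

Reveal the graph [G - v] first, and let [x :: s] be a longest path in it.  By
maximality all the neighbours of [x] in [G - v] are on this path.  If [z] is one
of them and [y] is the predecessor of [z], reversing the part of the path that
precedes [z] gives a path with the same vertices which starts at [y]; an edge
between [v] and [y] would extend it to a path in [G] that is longer than all the
paths avoiding [v].  Hence, if [v] is omittable, [v] is adjacent to no vertex of
the set [N] of these predecessors ([rotation_endpoints]).  Now [N] depends only
on [G - v], and is therefore independent of the edges at [v], and it has as many
elements as [x] has neighbours.  If this number is at least [beta2 * n * p_n],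
the local density hypothesis makes the expected number of edges between [v] and
[N] at least [beta1 * p_n * beta2 * n * p_n = x], so that no edge is present with
probability at most [exp (- x)] ([omittable_prob]).

The other case is a vertex of degree less than [beta2 * n * p_n] in [G - v].
Expected degrees there are at least [beta3 * n * p_n - 2], and
[beta3 > beta2], so a Chernoff bound and a union bound over the vertices give a
probability at most [n exp (- k n p_n)] for some constant [k > 0]
([low_degree_prob]).  Since [log n] and [n * p_n ^ 2] are both negligible with
respect to [n * p_n], this is at most [exp (- x)] for large [n].

The probabilities are computed on the finite product space of edge sets:
mutual independence of the edge events determines the law of the random set of
edges present in the graph ([prob_occurring], [integral_occurring]), and the
independence between the edges at [v] and the others becomes the distributivity
of the product over all pairs. *)

(** * Longest paths and rotations *)

Section Graph.
Variables (V : finType) (e : rel V).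

Lemma longest_path_max (s : seq V) :
  simple_path e s -> (size s <= longest_path e)%N.
Proof.
move=> es; have us : uniq s by case/andP: es.
have ss : (size s < #|V|.+1)%N by rewrite ltnS -(card_uniqP us) max_card.
apply: (@leq_bigmax_cond _ (fun k : 'I_#|V|.+1 =>
  [exists s : k.-tuple V, simple_path e s]) (@nat_of_ord _) (Ordinal ss)).
by apply/existsP; exists (in_tuple s).
Qed.

Lemma longest_path_witness :
  exists2 s : seq V, simple_path e s & size s = longest_path e.
Proof.
have [|k /existsP[s es] maxE] := @eq_bigmax_cond _
   [pred k : 'I_#|V|.+1 | [exists s : k.-tuple V, simple_path e s]]
   (@nat_of_ord _).
  apply/card_gt0P; exists ord0; apply/existsP; exists [tuple] => //.
by exists s => //; rewrite size_tuple; exact: esym maxE.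
Qed.

Definition omittable (v : V) : bool :=
  [exists s : (longest_path e).-tuple V, simple_path e s && (v \notin s)].

(** Fix one longest path: each vertex that it misses is omittable because of
this very path. *)
Lemma deficit_le_omittable :
  (#|V| <= longest_path e + #|[set v | omittable v]%SET|)%N.
Proof.
have [s es ss] := longest_path_witness.
have us : uniq s by case/andP: es.
rewrite -ss -(card_uniqP us) -(cardC (mem s)) leq_add2l.
apply/subset_leq_card/fintype.subsetP => v vs; rewrite inE.
apply/existsP; exists (tcast ss (in_tuple s)).
by rewrite val_tcast es /=; move: vs; rewrite !inE memtE val_tcast.
Qed.

Lemma longest_path_le : (longest_path e <= #|V|)%N.
Proof. by apply/bigmax_leqP => k _; rewrite -ltnS. Qed.

End Graph.

Lemma longest_path_ext (V : finType) (e e' : rel V) :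
  e =2 e' -> longest_path e = longest_path e'.
Proof.
move=> ee'; apply: eq_bigl => k; apply: eq_existsb => s.
by rewrite /simple_path (eq_sorted ee').
Qed.

Lemma longest_avoiding_path (V : finType) (e : rel V) (u v : V) : u != v ->
  exists (x : V) (s : seq V),
    [/\ simple_path e (x :: s), v \notin x :: s &
        forall t, simple_path e t -> v \notin t -> (size t <= size (x :: s))%N].
Proof.
move=> uv.
pose Q k := [exists s : k.-tuple V, simple_path e s && (v \notin s)].
have Q1 : Q 1 by apply/existsP; exists [tuple u]; rewrite /= inE eq_sym uv.
have Qb k : Q k -> (k <= #|V|)%N.
  case/existsP => s /andP[/andP[us _] _].
  by rewrite -(size_tuple s) -(card_uniqP us) max_card.
have [k /existsP[s /andP[es vs]] kmax] := ex_maxnP (ex_intro _ 1%N Q1) Qb.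
case: s es vs => -[|x s'] ss es vs; have sk := eqP ss.
  by have := kmax _ Q1; rewrite -sk.
exists x, s'; split=> // t et vt; rewrite sk; apply: kmax.
by apply/existsP; exists (in_tuple t); rewrite et vt.
Qed.

(** The relation [B] is the graph with [v] isolated, and [e] ranges over all the
ways of adding edges at [v]; the set [N] serves all of them.  It consists of the
vertices at which a longest path avoiding [v] can be made to start by reversing
an initial part of it, so that an edge between [v] and [N] yields a path longer
than any path avoiding [v].  Since reversal is possible at each neighbour of the
first vertex [x], there are as many such vertices as [x] has neighbours. *)
Lemma rotation_endpoints (V : finType) (B : rel V) (u v : V) :
  symmetric B -> irreflexive B -> (forall y, B v y = false) -> u != v ->
  exists x (N : {set V}), [/\ x != v, v \notin N, (#|B x| <= #|N|)%N &
    forall e : rel V, symmetric e ->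
      (forall y z, y != v -> z != v -> e y z = B y z) ->
      omittable e v -> {in N, forall y, ~~ e v y}].
Proof.
move=> Bsym Birr Bv uv.
have [x [s [Bs vs smax]]] := longest_avoiding_path B uv.
have [us /= ps] := andP Bs.
have vx : x != v by move: vs; rewrite inE negb_or eq_sym => /andP[].
(* A neighbour of [x] outside the path could be put in front of it. *)
have nbr z : B x z -> z \in s.
  move=> xz; have zv : z != v.
    by apply/eqP => zv; move: xz; rewrite zv Bsym Bv.
  have zx : z != x by apply: contraTneq xz => ->; rewrite Birr.
  apply: contraT => zs.
  suff: (size (z :: x :: s) <= size (x :: s))%N by rewrite ltnn.
  apply: smax.
    apply/andP; split; last by rewrite /= Bsym xz.
    by rewrite cons_uniq us in_cons negb_or zx zs.
  by rewrite in_cons negb_or eq_sym zv.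
(* For [z] in [s], the index of [z] in [s] is that of its predecessor in
   [x :: s]. *)
pose pr z := nth x (x :: s) (index z s).
exists x, (pr @: [set z | B x z])%SET; split=> //.
- apply/imsetP => -[z]; rewrite inE => /nbr zs vE; move: vs; rewrite vE.
  by rewrite mem_nth //= ltnS ltnW // index_mem.
- rewrite card_in_imset ?cardsE //.
  move=> z1 z2; rewrite !inE => /nbr z1s /nbr z2s /eqP.
  rewrite nth_uniq //= ?ltnS ?index_size // => /eqP i12.
  by rewrite -(nth_index x z1s) i12 nth_index.
move=> e esym eB /existsP[t /andP[et vt]] y /imsetP[z].
rewrite inE => xz ->; have zs := nbr _ xz; apply/negP => vpr.
have Be r : v \notin r -> sorted e r = sorted B r.
  elim: r => //= a [//|b r] IH; rewrite inE negb_or => /andP[va vbr].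
  rewrite /= eB ?(eq_sym _ v) //.
    by have /= -> := IH vbr.
  by apply: contraNneq vbr => ->; rewrite mem_head.
have: (size t <= size (x :: s))%N.
  apply: smax => //; move: et; rewrite /simple_path => /andP[-> /=].
  by rewrite Be.
rewrite size_tuple leqNgt => /negP; apply.
move: vpr; rewrite /pr; case/splitPr: zs us ps vs {Bs smax nbr} => p1 p2 us ps vs.
have zp1 : z \notin p1.
  move: us; rewrite /= cat_uniq /= => /andP[_ /and3P[_ + _]].
  by rewrite negb_or => /andP[].
rewrite index_cat (negPf zp1) /= eqxx addn0 -cat_cons nth_cat ltnSn -last_nth.
move=> vpr.
(* The longer path: [v], then [x :: p1] backwards, then [z :: p2]. *)
have -> : (size (x :: p1 ++ z :: p2)).+1
       = size (v :: rev (x :: p1) ++ z :: p2).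
  by rewrite /= !size_cat size_rev.
apply: longest_path_max; rewrite /simple_path.
have rotE : perm_eq (rev (x :: p1) ++ z :: p2) (x :: p1 ++ z :: p2).
  by rewrite -cat_cons perm_cat2r perm_rev.
apply/andP; split.
  by rewrite cons_uniq (perm_mem rotE) (perm_uniq rotE) vs us.
have := ps; rewrite -[path B x _]/(sorted B (x :: _)) -Be // /= cat_path.
case/andP=> ep1 /= /andP[_ ep2].
rewrite cat_path rev_cons last_rcons /= ep2 eB //; last first.
  apply/eqP => zv; case/negP: vs.
  by rewrite -zv -cat_cons mem_cat mem_head orbT.
rewrite xz !andbT -rev_cons -[path _ _ _]/(sorted e (v :: _)).
rewrite -rev_rcons rev_sorted.
by rewrite /= rcons_path vpr andbT (eq_path (e' := e)).
Qed.

(** * Random subsets of a finite set *)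

Section RandomSubset.
Variables (R : realType) (I : finType) (q : I -> R).

(** The law of the random subset that contains each [i] independently with
probability [q i]. *)
Definition subset_weight (A : {set I}) : R :=
  \prod_i (if i \in A then q i else 1 - q i).
Local Notation W := subset_weight.

Hypothesis q01 : forall i, 0 <= q i <= 1.

Lemma subset_weight_ge0 A : 0 <= W A.
Proof.
apply: prodr_ge0 => i _; have /andP[q0 q1] := q01 i.
by case: ifP => // _; rewrite subr_ge0.
Qed.

Lemma sum_subset_weight : \sum_A W A = 1.
Proof. by rewrite -bigA_distr big1 // => i _; rewrite /=; ring. Qed.

(** Given the part of the random set outside [J], no element of [K] is chosen
with the conditional probability [\prod_(i in K) (1 - q i)].  The set [K] may be
selected according to [B]: this is how the independence of disjoint sets of pairs
is used. *)
Lemma sum_weight_avoid (J K B : {set I}) : K \subset J ->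
  \sum_(A : {set I} | (A :\: J == B)%SET && [disjoint A & K]%B) W A =
  \prod_(i in K) (1 - q i) * \sum_(A : {set I} | (A :\: J == B)%SET) W A.
Proof.
move=> KJ.
(* Both sides are sums over all [A] of products over [i] whose factors [f] (for
   [i] in [A]) and [g] (otherwise) vanish when [A] violates the condition at
   [i]; distributivity turns them into the products of the [f + g]. *)
pose f (K' : {set I}) i := if i \in J then if i \in K' then 0 else q i
                            else if i \in B then q i else 0.
pose g i := if i \in J then 1 - q i else if i \in B then 0 else 1 - q i.
have fact (K' : {set I}) : (B \subset ~: J)%SET -> (K' \subset J) ->
  \sum_(A : {set I} | (A :\: J == B)%SET && [disjoint A & K']%B) W A =
  \prod_i (f K' i + g i).
  move=> BJ K'J; rewrite bigA_distr big_mkcond; apply: eq_bigr => A _.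
  have [/andP[/eqP AB AK]|nAB] := ifP.
    apply: eq_bigr => i _; rewrite /f /g.
    have iB : (i \in B) = (i \notin J) && (i \in A) by rewrite -AB inE.
    have iK : i \in A -> (i \in K') = false.
      by move=> iA; apply/negbTE; rewrite (disjointFr AK).
    by rewrite iB; case: (i \in J); case: ifP => // /iK ->.
  have [i Wi] : exists i, (if i \in A then f K' i else g i) = 0.
    move/negbT: nAB; rewrite negb_and => /orP[|].
      rewrite finset.eqEsubset negb_and => /orP[] /fintype.subsetPn[i]; rewrite ?inE.
        move=> /andP[iJ iA] iB; exists i.
        by rewrite /f iA (negPf iJ) (negPf iB).
      move=> iB; have := fintype.subsetP BJ i iB; rewrite inE => iJ.
      rewrite iJ /= => iA; exists i; by rewrite /g (negPf iA) (negPf iJ) iB.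
    rewrite disjoint_sym -finset.setI_eq0 => /finset.set0Pn[i].
    rewrite inE => /andP[iK iA].
    by exists i; rewrite iA /f iK (fintype.subsetP K'J).
  by rewrite (bigD1 i) //= Wi mul0r.
have [BJ|nBJ] := boolP (B \subset ~: J)%SET; last first.
  have noA (A : {set I}) : (A :\: J == B)%SET = false.
    apply: contraNF nBJ => /eqP <-; apply/fintype.subsetP => i.
    by rewrite !inE => /andP[].
  rewrite [LHS]big_pred0 => [|A]; last by rewrite noA.
  by rewrite [X in _ * X]big_pred0 ?mulr0.
have total : \sum_(A : {set I} | (A :\: J == B)%SET) W A
           = \prod_i (f finset.set0 i + g i).
  rewrite -fact ?finset.sub0set //; apply: eq_bigl => A.
  by rewrite disjoint_sym -finset.setI_eq0 finset.set0I eqxx andbT.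
rewrite total fact // [X in _ = X * _]big_mkcond -big_split /=; apply: eq_bigr => i _.
rewrite /f /g inE; case: (boolP (i \in K)) => [iK|iK]; last by rewrite mul1r.
by rewrite (fintype.subsetP KJ) //; ring.
Qed.

(** Chernoff's bound for the lower tail: the indicator of the event is at most
[exp (t * (m - #|A :&: J|))], whose mean is a product over [J].  The estimate
[exp (- t) <= 1 / (1 + t)] is what produces the constant [t / (1 + t)]. *)
Lemma lower_tail_weight (J : {set I}) (t m : R) : 0 <= t ->
  \sum_(A : {set I} | #|A :&: J|%SET%:R < m) W A <=
    expR (t * m - t / (1 + t) * \sum_(i in J) q i).
Proof.
move=> t0; rewrite mulr_sumr -sumrN expRD.
rewrite expR_sum.
apply: (@le_trans _ _ (expR (t * m) *
    \sum_(A : {set I}) W A * \prod_(i in (A :&: J)%SET) expR (- t))).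
  rewrite mulr_sumr big_mkcond; apply: ler_sum => A _.
  have := subset_weight_ge0 A; case: ifPn => [Am|_] W0; last first.
    by rewrite mulr_ge0 ?expR_ge0// mulr_ge0// prodr_ge0// => i _; exact: expR_ge0.
  rewrite prodr_const -expRM_natl mulrCA -expRD ler_peMr //.
  rewrite -[leLHS](expR0 R) ler_expR.
  suff : 0 <= t * (m - #|A :&: J|%SET%:R) by lra.
  by rewrite mulr_ge0 // subr_ge0 ltW.
rewrite ler_pM2l ?expR_gt0//.
have -> : \sum_(A : {set I}) W A * \prod_(i in (A :&: J)%SET) expR (- t) =
  \prod_i ((if i \in J then q i * expR (- t) else q i) + (1 - q i)).
  rewrite bigA_distr; apply: eq_bigr => A _.
  rewrite [X in _ * X]big_mkcond -big_split /=; apply: eq_bigr => i _.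
  by rewrite inE; case: (i \in A); case: (i \in J) => //=; rewrite mulr1.
rewrite [leRHS]big_mkcond; apply: ler_prod => i _; have /andP[q0 q1] := q01 i.
apply/andP; split.
  by apply: addr_ge0; [case: ifP => // _; rewrite mulr_ge0// expR_ge0|lra].
case: ifP => _; last lra.
apply: le_trans (expR_ge1Dx _).
have t1 : 0 < 1 + t by lra.
have : expR (- t) <= (1 + t)^-1.
  by rewrite expRN lef_pV2 ?posrE ?expR_gt0// expR_ge1Dx.
move=> /(ler_wpM2l q0).
suff -> : t / (1 + t) = 1 - (1 + t)^-1 by nra.
by field; lra.
Qed.

End RandomSubset.

(** * The law of the set of independent events that occur *)

Section Bridge.
Variables (R : realType) (d : measure_display) (T : measurableType d).
Variables (P : probability T R) (I : finType) (E : I -> set T) (q : I -> R).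
Hypothesis mE : forall i, measurable (E i).
Hypothesis E_indep : forall B : {set I},
  P (\bigcap_(i in [set` B]) E i) = (\prod_(i in B) q i)%:E.

Definition occurring (w : T) : {set I} := [set i | `[< E i w >]]%SET.

Let capE (B : {set I}) := \bigcap_(i in [set` B]) E i.
Let capC (B : {set I}) := \bigcap_(i in [set` B]) ~` E i.

Let mcapE B : measurable (capE B).
Proof. by apply: fin_bigcap_measurable => // i _. Qed.
Let mcapC B : measurable (capC B).
Proof. by apply: fin_bigcap_measurable => // i _; exact: measurableC. Qed.

(** Independence for intersections of the events extends to their complements,
by induction on the number of complements: replacing [~` E b] by [E b] in a
pattern gives the probability to be subtracted. *)
Let prob_pattern (B A : {set I}) : [disjoint A & B]%B ->
  P (capE A `&` capC B) = (\prod_(i in A) q i * \prod_(i in B) (1 - q i))%:E.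
Proof.
elim: {B}#|B| {-2}B (erefl #|B|) A => [|k IH] B cB A AB.
  have -> : B = finset.set0 by apply/eqP; rewrite -cards_eq0 cB.
  rewrite big_set0 mulr1 -E_indep; congr (P _).
  rewrite /capC (_ : [set` _] = set0) ?bigcap_set0 ?setIT//.
  by apply/seteqP; split => i //=; rewrite inE.
have [b bB] : exists b, b \in B by apply/card_gt0P; rewrite cB.
have bA : b \notin A by rewrite (disjointFl AB).
pose B' := (B :\ b)%SET.
have BE : B = (b |: B')%SET by rewrite finset.setD1K.
have bB' : b \notin B' by rewrite !inE eqxx.
have cB' : #|B'| = k by move: cB; rewrite (cardsD1 b) bB => -[].
have AB' : [disjoint A & B']%B by apply: disjointWr AB; exact: finset.subsetDl.
have bAB' : [disjoint (b |: A)%SET & B']%B.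
  rewrite finset.disjoints_subset finset.subUset finset.sub1set finset.in_setC.
  by rewrite bB' /= -finset.disjoints_subset.
have -> : capE A `&` capC B = (capE A `&` capC B') `\` (capE (b |: A)%SET `&` capC B').
  apply/seteqP; split => [w [wA wB]|w [[wA wB'] wn]].
    split; first by split => // i iB'; apply: wB; rewrite /= BE finset.setU1r.
    move=> [wbA _]; by apply: (wB b) => //; apply: wbA; rewrite /= finset.setU11.
  split=> // i /=; rewrite {1}BE !inE => /orP[/eqP ->|]; last first.
    by move=> iB'; apply: wB'; rewrite /= !inE.
  move=> wb; apply: wn; split=> // j /=; rewrite !inE => /orP[/eqP ->//|jA].
  exact: wA.
rewrite measureD //=; last 3 first.
- by apply: measurableI.
- by apply: measurableI.
- by apply: (le_lt_trans (probability_le1 _ _)); rewrite ?ltry//; apply: measurableI.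
rewrite setIACA setIid (_ : capE A `&` capE _ = capE (b |: A)%SET); last first.
  apply/seteqP; split=> [w []//|w wA]; split=> // i iA.
  by apply: wA; rewrite /= inE iA orbT.
rewrite !IH // -EFinB; congr EFin.
rewrite BE !big_setU1 //=; ring.
Qed.

Let atomE A : occurring @^-1` [set A] = capE A `&` capC (~: A)%SET.
Proof.
apply/seteqP; split => [w /= <-|w [wA wC]].
  split => i /=; rewrite !inE //.
  by move/asboolPn.
apply/finset.setP => i; rewrite inE; apply/asboolP/idP => [Ei|/wA//].
by apply: contraT => iA; case: (wC i) => //=; rewrite inE.
Qed.

Lemma measurable_occurring (X : set {set I}) : measurable (occurring @^-1` X).
Proof.
rewrite (_ : _ @^-1` _ = \bigcup_(A in X) (occurring @^-1` [set A])); last first.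
  apply/seteqP; split => [w Xw|w [A XA wA]]; first by exists (occurring w).
  by rewrite /preimage /= wA.
apply: fin_bigcup_measurable => [|A _]; last by rewrite atomE; exact: measurableI.
exact: finite_finset.
Qed.

Lemma prob_occurring_atom A : P (occurring @^-1` [set A]) = (subset_weight q A)%:E.
Proof.
rewrite atomE prob_pattern; last by rewrite -finset.setI_eq0 finset.setICr.
rewrite /subset_weight [in RHS](bigID (mem A)) /=; congr EFin; congr (_ * _).
  by apply: eq_bigr => i ->.
by apply: eq_big => [i|i]; rewrite !inE // => /negPf ->.
Qed.

(** A function of the random set is a finite linear combination of indicators of
its atoms. *)
Lemma integral_occurring (F : {set I} -> R) : (forall A, 0 <= F A) ->
  (\int[P]_w (F (occurring w))%:E = (\sum_A subset_weight q A * F A)%:E)%E.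
Proof.
move=> F0.
transitivity (\int[P]_w (\sum_(A : {set I})
   (F A)%:E * (\1_(occurring @^-1` [set A]) w)%:E))%E.
  apply: eq_integral => w _.
  rewrite (bigD1 (occurring w)) //= indicE mem_set // mule1 big1 ?adde0//.
  by move=> A Aw; rewrite indicE memNset ?mule0// => /= AE; rewrite AE eqxx in Aw.
rewrite ge0_integral_sum //; last 2 first.
- move=> A; apply: emeasurable_funM; first exact: measurable_cst.
  apply/measurable_EFinP; apply: measurable_indic; exact: measurable_occurring.
- by move=> A w _; rewrite mule_ge0 ?lee_fin ?F0// indicE; case: (_ \in _).
rewrite -sumEFin; apply: eq_bigr => A _.
rewrite ge0_integralZl ?lee_fin //; last first.
  by apply/measurable_EFinP; apply: measurable_indic; exact: measurable_occurring.
rewrite integral_indic //; last exact: measurable_occurring.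
transitivity ((F A)%:E * (subset_weight q A)%:E)%E; last by rewrite -EFinM mulrC.
by rewrite setIT; congr (_ * _)%E; exact: prob_occurring_atom.
Qed.

Lemma prob_occurring (X : pred {set I}) :
  P [set w | X (occurring w)] = (\sum_(A | X A) subset_weight q A)%:E.
Proof.
have mX := measurable_occurring [set A | X A].
rewrite -[LHS](_ : (\int[P]_w ((X (occurring w))%:R : R)%:E)%E = _).
  rewrite (integral_occurring (F := fun A => (X A)%:R)) // [in RHS]big_mkcond.
  by congr EFin; apply: eq_bigr => A _; case: (X A); rewrite ?mulr1 ?mulr0.
rewrite -[in RHS](setIT [set w | _]) -integral_indic //; apply: eq_integral => w _.
rewrite indicE; case Xw: (X (occurring w)); first by rewrite mem_set.
by rewrite memNset //= Xw.
Qed.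

End Bridge.

(** * Random graphs as random sets of pairs *)

Section PairGraph.
Variable n : nat.
Implicit Types (i j v : 'I_n) (A B : {set 'I_n * 'I_n}).

(** The increasing ordering of an unordered pair, as in [vertex_pairs]. *)
Definition pair_key i j : 'I_n * 'I_n := if (i < j)%N then (i, j) else (j, i).

Definition pair_graph A : rel 'I_n := fun i j => (i != j) && (pair_key i j \in A).

Definition star v : {set 'I_n * 'I_n} := [set e | (e.1 == v) || (e.2 == v)]%SET.

Lemma pair_keyC i j : pair_key i j = pair_key j i.
Proof.
by rewrite /pair_key; case: ltngtP => // ij; have -> : i = j by apply: val_inj.
Qed.

Lemma pair_key_inj i : injective (pair_key i).
Proof.
move=> j k; rewrite /pair_key.
by case: ifP => _; case: ifP => _ [] *; congruence.
Qed.

Lemma pair_graph_sym A : symmetric (pair_graph A).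
Proof. by move=> i j; rewrite /pair_graph eq_sym pair_keyC. Qed.

Lemma pair_graph_irr A : irreflexive (pair_graph A).
Proof. by move=> i; rewrite /pair_graph eqxx. Qed.

Lemma pair_key_star v i j : (pair_key i j \in star v) = (i == v) || (j == v).
Proof. by rewrite inE /pair_key; case: ifP => //= _; rewrite orbC. Qed.

Lemma pair_graph_unstar A v i j :
  pair_graph (A :\: star v)%SET i j = [&& pair_graph A i j, i != v & j != v].
Proof.
rewrite /pair_graph finset.in_setD pair_key_star negb_or.
by case: (i == j); case: (i == v); case: (j == v); case: (_ \in A).
Qed.

End PairGraph.

Section Model.
Variables (R : realType) (n : nat) (p : 'I_n -> 'I_n -> R).
Hypothesis p01 : forall i j, i != j -> 0 <= p i j <= 1.
Hypothesis psym : forall i j, i != j -> p i j = p j i.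

(** Giving probability 0 to the non-increasing pairs lets the random edge set
range over all the sets of ordered pairs. *)
Definition pair_prob (e : 'I_n * 'I_n) : R :=
  if (e.1 < e.2)%N then p e.1 e.2 else 0.

Lemma pair_prob01 e : 0 <= pair_prob e <= 1.
Proof.
rewrite /pair_prob; case: ifP => [e12|_]; last by rewrite lexx ler01.
by apply: p01; rewrite neq_ltn e12.
Qed.

Lemma pair_prob_key i j : i != j -> pair_prob (pair_key i j) = p i j.
Proof.
move=> ij; rewrite /pair_prob /pair_key.
case: (ltnP i j) => [->//|]; rewrite leq_eqVlt => /orP[/eqP/val_inj jE|ji].
  by rewrite jE eqxx in ij.
by rewrite /= ji psym // eq_sym.
Qed.

Local Notation W := (subset_weight pair_prob).
Let W0 A : 0 <= W A := subset_weight_ge0 pair_prob01 A.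

Definition degrees_above (m : R) (v : 'I_n) (A : {set 'I_n * 'I_n}) : bool :=
  [forall i, (i != v) ==> (m <= #|pair_graph (A :\: star v)%SET i|%:R)].

(** Condition on the set [B] of edges that are not at [v].  If [B] has the
required degrees, [rotation_endpoints] gives a set [N], determined by [B], with
no edge between [v] and [N] when [v] is omittable; by independence this has
conditional probability
[\prod_(y in N) (1 - p v y) <= exp (- \sum_(y in N) p v y) <= exp (- x)]. *)
Lemma omittable_prob (v : 'I_n) (m x : R) : (1 < n)%N ->
  (forall S : {set 'I_n}, v \notin S -> m <= #|S|%:R -> x <= \sum_(j in S) p v j) ->
  \sum_(A | omittable (pair_graph A) v && degrees_above m v A) W A <= expR (- x).
Proof.
move=> n1 hS.
have [u uv] : exists u : 'I_n, u != v.
  have /card_gt0P[u] : (0 < #|[set~ v]%SET|)%N.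
    by rewrite cardsC1 card_ord -ltnS prednK // ltnW.
  by rewrite !inE; exists u.
rewrite (partition_big (fun A => A :\: star v)%SET xpredT) //=.
rewrite -[leRHS]mulr1 -(sum_subset_weight pair_prob).
rewrite [X in _ * X](partition_big (fun A => A :\: star v)%SET xpredT) //= mulr_sumr.
apply: ler_sum => B _.
case: (pickP (fun A => omittable (pair_graph A) v && degrees_above m v A
                       && (A :\: star v == B)%SET)) => [A0|noA]; last first.
  by rewrite big_pred0 // mulr_ge0 ?expR_ge0// sumr_ge0.
case/andP=> /andP[_ /forallP degA0] /eqP A0B.
have Bv y : pair_graph B v y = false.
  by rewrite -A0B pair_graph_unstar eqxx andbF.
have [x0 [N [x0v vN degN hN]]] :=
  rotation_endpoints (@pair_graph_sym _ B) (@pair_graph_irr _ B) Bv uv.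
have mN : m <= #|N|%:R.
  have := degA0 x0; rewrite x0v A0B /= => /le_trans; apply.
  by rewrite ler_nat.
pose K := (pair_key v @: N)%SET.
have KJ : K \subset star v.
  by apply/fintype.subsetP => e /imsetP[y _ ->]; rewrite pair_key_star eqxx.
apply: (@le_trans _ _ (\sum_(A | (A :\: star v == B)%SET && [disjoint A & K]%B) W A)).
  rewrite big_mkcond [leRHS]big_mkcond; apply: ler_sum => A _.
  case: ifPn => [|_]; last by case: ifP.
  case/andP=> /andP[omA _] /eqP AB; rewrite AB eqxx /=.
  case: ifPn => // /negP[].
  rewrite -finset.setI_eq0; apply/eqP/finset.setP => e; rewrite !inE; apply/negP.
  case/andP=> eA /imsetP[y yN eE].
  have AB' a b : a != v -> b != v -> pair_graph A a b = pair_graph B a b.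
    by move=> av bv; rewrite -AB pair_graph_unstar av bv !andbT.
  have /negP[] := hN _ (@pair_graph_sym _ A) AB' omA y yN.
  by rewrite /pair_graph -eE eA andbT; apply: contraNneq vN => ->.
rewrite (sum_weight_avoid _ _ KJ) ler_wpM2r ?sumr_ge0//.
rewrite big_imset /=; last by move=> a b _ _ /pair_key_inj.
have pvy y : y \in N -> v != y by move=> yN; apply: contraNneq vN => ->.
apply: (@le_trans _ _ (\prod_(y in N) expR (- p v y))).
  apply: ler_prod => y /pvy vy; rewrite pair_prob_key //.
  by have /andP[p0 p1] := p01 vy; rewrite subr_ge0 p1 expR_ge1Dx.
by rewrite -expR_sum ler_expR sumrN lerN2 hS.
Qed.

(** The pairs that join [i] to the vertices other than [v] are chosen
independently; [J] is the set of these pairs, so that the degree of [i] away from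
[v] is the number of elements of the random set in [J]. *)
Lemma low_degree_prob (v i : 'I_n) (m mu t : R) : 0 <= t ->
  mu <= \sum_(j | (j != i) && (j != v)) p i j ->
  i != v ->
  \sum_(A | #|pair_graph (A :\: star v)%SET i|%:R < m) W A
    <= expR (t * m - t / (1 + t) * mu).
Proof.
move=> t0 hmu iv.
pose D := [set j | (j != i) && (j != v)]%SET.
pose J := (pair_key i @: D)%SET.
have degE A : #|pair_graph (A :\: star v)%SET i| = #|A :&: J|%SET.
  rewrite -(card_imset _ (@pair_key_inj n i)); apply: eq_card => e; rewrite inE.
  apply/imsetP/andP => [[j Aij ->]|[eA /imsetP[j]]].
    have : pair_graph (A :\: star v)%SET i j by [].
    rewrite pair_graph_unstar => /and3P[/andP[ij jA] _ jv]; split=> //.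
    by apply: imset_f; rewrite inE eq_sym ij.
  rewrite inE => /andP[ji jv] eE; exists j => //.
  rewrite -[_ \in _]/(pair_graph (A :\: star v)%SET i j).
  by rewrite pair_graph_unstar iv jv /pair_graph eq_sym ji -eE eA.
under eq_bigl do rewrite degE.
apply: le_trans (lower_tail_weight pair_prob01 _ _ t0) _; rewrite ler_expR.
rewrite lerD2l lerN2 ler_wpM2l ?divr_ge0 ?addr_ge0//.
rewrite big_imset /=; last by move=> a b _ _ /pair_key_inj.
apply: le_trans hmu _; rewrite le_eqVlt; apply/orP; left; apply/eqP.
by apply: eq_big => [j|j /andP[ji _]]; rewrite ?inE // pair_prob_key // eq_sym.
Qed.

(** By [deficit_le_omittable] the deficit is at most the number of omittable
vertices [v]; for each of them either the degrees in the graph without [v] are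
all at least [m], or one of at most [n] vertices has a smaller degree. *)
Lemma deficit_expectation (m x mu t : R) : (1 < n)%N -> 0 <= t ->
  (forall (v : 'I_n) (S : {set 'I_n}),
     v \notin S -> m <= #|S|%:R -> x <= \sum_(j in S) p v j) ->
  (forall i v : 'I_n, i != v ->
     mu <= \sum_(j | (j != i) && (j != v)) p i j) ->
  \sum_A W A * (n%:R - (longest_path (pair_graph A))%:R) <=
    n%:R * (expR (- x) + n%:R * expR (t * m - t / (1 + t) * mu)).
Proof.
move=> n1 t0 hS hmu.
apply: (@le_trans _ _ (\sum_A W A * \sum_(v : 'I_n) (omittable (pair_graph A) v)%:R)).
  apply: ler_sum => A _; apply: ler_wpM2l => //.
  rewrite lerBlDl -natr_sum -natrD ler_nat.
  have := deficit_le_omittable (pair_graph A); rewrite card_ord.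
  by rewrite cardsE -sum1_card big_mkcond.
under eq_bigr do rewrite mulr_sumr.
rewrite exchange_big /=.
rewrite mulr_natl -[X in _ *+ X](card_ord n) -sumr_const; apply: ler_sum => v _.
apply: (@le_trans _ _ (\sum_A
    ((if omittable (pair_graph A) v && degrees_above m v A then W A else 0) +
     \sum_(i | i != v)
       (if #|pair_graph (A :\: star v)%SET i|%:R < m then W A else 0)))).
  apply: ler_sum => A _; have WA := W0 A.
  have low0 (Q : pred 'I_n) : 0 <= \sum_(i | Q i)
      (if #|pair_graph (A :\: star v)%SET i|%:R < m then W A else 0).
    by apply: sumr_ge0 => i _; case: ifP.
  case: (omittable _ v) => /=; last by rewrite mulr0 add0r.
  rewrite mulr1; case: ifPn => [_|]; first by rewrite lerDl.
  rewrite negb_forall => /existsP[i]; rewrite negb_imply -ltNge => /andP[iv lowi].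
  by rewrite add0r (bigD1 i) //= lowi lerDl.
rewrite big_split /= -big_mkcond exchange_big /=; apply: lerD.
  exact: omittable_prob (hS v).
apply: (@le_trans _ _ (\sum_(i : 'I_n | i != v) expR (t * m - t / (1 + t) * mu))).
  apply: ler_sum => i iv; rewrite -big_mkcond.
  exact: low_degree_prob (hmu i v iv) iv.
rewrite mulr_natl -[X in _ *+ X](card_ord n) -sumr_const big_mkcond /=.
by apply: ler_sum => i _; case: ifP => // _; exact: expR_ge0.
Qed.

End Model.

(** * The expected deficit *)

Section Deficit.
Variables (R : realType) (n : nat) (p : 'I_n -> 'I_n -> R).
Hypothesis p01 : forall i j, i != j -> 0 <= p i j <= 1.
Hypothesis psym : forall i j, i != j -> p i j = p j i.

Definition expected_deficit : R :=
  \sum_A subset_weight (pair_prob p) A *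
    (n%:R - (longest_path (pair_graph A))%:R).

Lemma deficit_ge0 (e : rel 'I_n) : 0 <= n%:R - (longest_path e)%:R :> R.
Proof.
by rewrite subr_ge0 ler_nat -[X in (_ <= X)%N](card_ord n) longest_path_le.
Qed.

(** Markov's inequality for the deficit, in terms of a property [X] of the length
whose failure forces a deficit of at least [a]. *)
Lemma deficit_markov (a : R) (X : pred nat) : 0 < a ->
  (forall k, (k <= n)%N -> ~~ X k -> a <= n%:R - k%:R) ->
  1 - expected_deficit / a <=
    \sum_(A | X (longest_path (pair_graph A))) subset_weight (pair_prob p) A.
Proof.
move=> a0 hX; rewrite lerBlDr -lerBlDl -(sum_subset_weight (pair_prob p)).
rewrite ler_pdivlMr // (bigID (fun A => X (longest_path (pair_graph A)))) /=.
rewrite addrC addrK mulr_suml big_mkcond; apply: ler_sum => A _.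
have WA := subset_weight_ge0 (pair_prob01 p01) A.
case: ifPn => [nX|_]; last by rewrite mulr_ge0 ?deficit_ge0.
rewrite ler_wpM2l ?hX //.
by rewrite -[X in (_ <= X)%N](card_ord n) longest_path_le.
Qed.

Section ER.
Variables (d : measure_display) (T : measurableType d) (P : probability T R).
Variable (G : T -> rel 'I_n).
Hypothesis hG : inhomogeneous_ER P p G.

(* Pairs outside [vertex_pairs] get the empty event, in accordance with the value
   0 of [pair_prob]. *)
Let E ij : set T := if ij \in vertex_pairs n then edge_event G ij else set0.

Let mE ij : measurable (E ij).
Proof. by rewrite /E; case: ifPn => // /(ER_measurable hG). Qed.

Let E_indep (B : {set 'I_n * 'I_n}) :
  P (\bigcap_(ij in [set` B]) E ij) = (\prod_(ij in B) pair_prob p ij)%:E.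
Proof.
have [BV|/fintype.subsetPn[ij ijB ijV]] := boolP (B \subset vertex_pairs n).
  have BVin ij : ij \in B -> ij \in vertex_pairs n by move/(fintype.subsetP BV).
  transitivity (P (\bigcap_(ij in [set` B]) edge_event G ij)).
    by congr (P _); apply: eq_bigcapr => ij /= /BVin ijV; rewrite /E ijV.
  rewrite (ER_indep hG BV) -prodEFin; apply: eq_bigr => ij /BVin ijV.
  by rewrite (ER_prob hG ijV) /pair_prob; move: ijV; rewrite inE => ->.
transitivity (P set0).
  congr (P _); apply/seteqP; split=> // w /(_ ij ijB).
  by rewrite /E (negPf ijV).
rewrite measure0 (bigD1 ij) //= /pair_prob.
by move: ijV; rewrite inE => /negPf ->; rewrite mul0r.
Qed.

Let G_occurring w : G w =2 pair_graph (occurring E w).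
Proof.
have Gk (i j : 'I_n) : (i < j)%N -> G w i j = ((i, j) \in occurring E w).
  move=> ij; rewrite inE /E inE ij /edge_event /=.
  by apply/idP/asboolP.
move=> i j; rewrite /pair_graph /pair_key; case: ltngtP => [ij|ji|/val_inj ->].
- by rewrite Gk // neq_ltn ij.
- by rewrite (ER_sym hG) Gk // neq_ltn ji orbT.
- by rewrite (ER_irrefl hG) eqxx.
Qed.

Lemma prob_longest_path (X : pred nat) :
  P [set w | X (longest_path (G w))] =
  (\sum_(A | X (longest_path (pair_graph A))) subset_weight (pair_prob p) A)%:E.
Proof.
rewrite -(prob_occurring mE E_indep (fun A => X (longest_path (pair_graph A)))).
by congr (P _); apply/seteqP; split => w /=; rewrite (longest_path_ext (G_occurring w)).
Qed.

Lemma expectation_path_length :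
  'E_P[path_length R G]%E = (n%:R - expected_deficit)%:E.
Proof.
rewrite unlock.
transitivity (\int[P]_w ((longest_path (pair_graph (occurring E w)))%:R)%:E)%E.
  by apply: eq_integral => w _; rewrite /path_length (longest_path_ext (G_occurring w)).
rewrite (integral_occurring mE E_indep
  (F := fun A => (longest_path (pair_graph A))%:R)) //.
congr EFin; rewrite /expected_deficit; under [in RHS]eq_bigr do rewrite mulrBr.
rewrite big_split /= -mulr_suml sum_subset_weight mul1r sumrN.
by rewrite opprD addrA subrr add0r opprK.
Qed.

End ER.
End Deficit.

(** All the requirements that hold only for large [n] are gathered in the last
three hypotheses, with one constant [c] depending on the [beta]s only: the first
one absorbs the loss of 2 in [beta3 * n * pn - 2], and the other two make the
union bound for the degrees smaller than [exp (- beta1 * beta2 * n * pn ^ 2)]. *)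
Lemma deficit_exponential_bound (R : realType) (beta1 beta2 beta3 : R)
  (hbeta1 : 0 < beta1) (hbeta12 : beta1 <= beta2)
  (hbeta23 : beta2 < beta3) (hbeta3 : beta3 <= 1) :
  exists2 c : R, 0 < c &
  forall (n : nat) (pn : R) (p : 'I_n -> 'I_n -> R), (1 < n)%N -> 0 < pn < 1 ->
    (forall i j, i != j -> 0 <= p i j <= 1) ->
    (forall i j, i != j -> p i j = p j i) ->
    ((beta3 * pn)%:E <= inf_mean_prob p)%E ->
    ((beta1 * pn)%:E <= inf_local_mean_prob p (beta2 * n%:R * pn))%E ->
    1 <= c * (n%:R * pn) ->
    ln n%:R <= c * (n%:R * pn) ->
    pn <= c ->
    expected_deficit p <= 2 * n%:R * expR (- (beta1 * beta2 * n%:R * pn ^+ 2)).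
Proof.
have beta2_gt0 : 0 < beta2 by lra.
(* [b * n * pn] is the lower bound for the mean degrees once a vertex is removed,
   and [t] is small enough for the rate [k] in Chernoff's bound at level
   [beta2 * n * pn] to be positive: [1 + t = (b + beta2) / (2 * beta2)]. *)
pose b := (beta2 + beta3) / 2.
pose t := (b - beta2) / (2 * beta2).
have t0 : 0 < t by rewrite divr_gt0 /b; lra.
pose k := t * (b / (1 + t) - beta2).
have k0 : 0 < k.
  rewrite mulr_gt0 // subr_gt0 ltr_pdivlMr; last lra.
  have -> : beta2 * (1 + t) = (b + beta2) / 2 by rewrite /t; field; lra.
  by rewrite /b; lra.
(* One requirement each: [c1] for the mean degrees, [k / 2] for [ln n] and [c3]
   for the exponent [beta1 * beta2 * n * pn ^ 2]. *)
pose c1 := (beta3 - b) / 2.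
pose c3 := k / (2 * (beta1 * beta2)).
have c10 : 0 < c1 by rewrite /c1 /b; lra.
have b12 : 0 < beta1 * beta2 by rewrite mulr_gt0.
have c30 : 0 < c3 by rewrite divr_gt0 // mulr_gt0.
exists (Num.min c1 (Num.min (k / 2) c3)).
  by rewrite !lt_min c10 c30 divr_gt0.
set c := Num.min _ _.
have cc1 : c <= c1 by rewrite ge_min lexx.
have ck : c <= k / 2 by rewrite !ge_min lexx orbT.
have cc3 : c <= c3 by rewrite !ge_min lexx !orbT.
move=> n pn p n1 /andP[pn0 pn1] p01 psym hmean hlocal hc hln hpnc.
have n0 : 0 < n%:R :> R by rewrite ltr0n ltnW.
have np0 : 0 < n%:R * pn by rewrite mulr_gt0.
pose m := beta2 * n%:R * pn.
pose x := beta1 * beta2 * n%:R * pn ^+ 2.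
pose mu := b * (n%:R * pn).
have hS (v : 'I_n) (S : {set 'I_n}) :
    v \notin S -> m <= #|S|%:R -> x <= \sum_(j in S) p v j.
  move=> vS mS.
  have S0 : 0 < #|S|%:R :> R.
    by apply: lt_le_trans mS; rewrite /m -mulrA mulr_gt0.
  have : ((beta1 * pn)%:E <= ((#|S|%:R)^-1 * \sum_(j in S) p v j)%:E)%E.
    apply: le_trans hlocal _; rewrite /inf_local_mean_prob.
    apply: (@le_trans _ _ (ereal_inf [set ((#|S0|%:R)^-1 * \sum_(j in S0) p v j)%:E
       | S0 in [set S0 : {set 'I_n} | v \notin S0 /\ m <= #|S0|%:R]])).
      by apply: ereal_inf_lbound; exists v.
    by apply: ereal_inf_lbound; exists S.
  rewrite lee_fin [leRHS]mulrC ler_pdivlMr // => /(le_trans _); apply.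
  rewrite /x (_ : _ * pn ^+ 2 = beta1 * pn * m); last by rewrite /m; ring.
  by rewrite ler_wpM2l // mulr_ge0 ?ltW.
have hmu (i v : 'I_n) : i != v ->
    mu <= \sum_(j | (j != i) && (j != v)) p i j.
  move=> iv.
  have : ((beta3 * pn)%:E <= ((n%:R - 1)^-1 * \sum_(j | j != i) p i j)%:E)%E.
    apply: le_trans hmean _.
    by apply: ereal_inf_lbound; exists i.
  have n10 : 0 < n%:R - 1 :> R by rewrite subr_gt0 ltr1n.
  rewrite lee_fin [leRHS]mulrC ler_pdivlMr // (bigD1 v) /=; last by rewrite eq_sym.
  have /andP[_ piv] := p01 _ _ iv.
  (* Removing [v] loses at most 1, and so does replacing [n - 1] by [n]. *)
  move=> h; have : beta3 * pn * (n%:R - 1) - 1 <= \sum_(j | (j != i) && (j != v)) p i j.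
    by lra.
  apply: le_trans.
  have : beta3 * pn <= 1 by apply: mulr_ile1; lra.
  have : 1 <= c1 * (n%:R * pn).
    by apply: le_trans hc _; rewrite ler_wpM2r // ltW.
  by rewrite /mu /c1; nra.
apply: le_trans (deficit_expectation p01 psym n1 (ltW t0) hS hmu) _.
rewrite (_ : 2 * n%:R * _ = n%:R * (expR (- x) + expR (- x))); last by rewrite /x; ring.
rewrite ler_wpM2l ?(ltW n0) // lerD2l.
rewrite -[X in X * _](lnK (x := n%:R)) ?posrE // -expRD ler_expR.
have -> : t * m - t / (1 + t) * mu = - (k * (n%:R * pn)).
  by rewrite /m /mu /k; field; lra.
have h1 : ln n%:R <= k / 2 * (n%:R * pn).
  by apply: le_trans hln _; rewrite ler_wpM2r // ltW.
have : beta1 * beta2 * pn <= k / 2.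
  rewrite mulrC -ler_pdivlMr // (_ : _ / _ / _ = c3) ?(le_trans hpnc) //.
  by rewrite /c3; field; rewrite !gt_eqF.
move=> /(ler_wpM2r (ltW np0)) h2.
have -> : x = beta1 * beta2 * pn * (n%:R * pn) by rewrite /x; ring.
lra.
Qed.

(** * Asymptotics *)

Theorem theorem1 (R : realType) (beta1 beta2 beta3 : R)
  (hbeta1 : 0 < beta1) (hbeta12 : beta1 <= beta2)
  (hbeta23 : beta2 < beta3) (hbeta3 : beta3 <= 1)
  (pn : nat -> R)
  (hpn : forall n : nat, (3 <= n)%N -> 0 < pn n < 1)
  (p : forall n : nat, 'I_n -> 'I_n -> R)
  (hp01 : forall n : nat, (3 <= n)%N ->
     forall i j : 'I_n, i != j -> 0 <= p n i j <= 1)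
  (hpsym : forall n : nat, (3 <= n)%N ->
     forall i j : 'I_n, i != j -> p n i j = p n j i)
  (d : nat -> measure_display) (T : forall n : nat, measurableType (d n))
  (P : forall n : nat, probability (T n) R)
  (G : forall n : nat, T n -> rel 'I_n)
  (hG : forall n : nat, (3 <= n)%N -> inhomogeneous_ER (P n) (p n) (G n))
  (hmean : \forall n \near \oo,
     ((beta3 * pn n)%:E <= inf_mean_prob (p n))%E)
  (hlocal : \forall n \near \oo,
     ((beta1 * pn n)%:E <= inf_local_mean_prob (p n) (beta2 * n%:R * pn n))%E)
  (hpn0 : pn n @[n --> \oo] --> (0 : R))
  (hlog : (ln n%:R / (n%:R * pn n)) @[n --> \oo] --> (0 : R)) :
  let L (n : nat) : T n -> R := path_length R (G n) in
  [/\ (* (i) *)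
      \forall n \near \oo,
        ((n%:R - 2 * n%:R * expR (- (beta1 * beta2 * n%:R * pn n ^+ 2)))%:E
           <= 'E_(P n)[L n])%E,
      (* (ii) *)
      forall delta : R, 0 < delta < 1 ->
        \forall n \near \oo,
          ((1 - expR (- (beta1 * beta2 * delta * n%:R * pn n ^+ 2)))%:E
             <= P n [set w | (n%:R - 2 * n%:R *
                   expR (- (beta1 * beta2 * (1 - delta) * n%:R * pn n ^+ 2))
                 <= L n w)%R])%E
    & (* (iii) *)
      forall M : R, (beta1 * beta2)^-1 < M ->
        (\forall n \near \oo, n%:R * pn n ^+ 2 = M * ln n%:R) ->
        let M1 := M * beta1 * beta2 in
        \forall n \near \oo,
          ((n%:R - 2 / n%:R `^ (M1 - 1))%:E <= 'E_(P n)[L n])%E /\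
          ((1 - 2 / n%:R `^ (M1 - 1))%:E <= P n [set w | L n w = n%:R%R])%E].
Proof.
move=> L.
have [c c0 hc] := deficit_exponential_bound hbeta1 hbeta12 hbeta23 hbeta3.
pose x n : R := beta1 * beta2 * n%:R * pn n ^+ 2.
have hD : \forall n \near \oo, (3 <= n)%N /\
    expected_deficit (p n) <= 2 * n%:R * expR (- x n).
  (* As [ln n >= ln 2], the factor [ln 2] in [eps] makes the convergence of
     [ln n / (n * pn)] also give the lower bound on [n * pn]. *)
  pose eps : R := c * Num.min 1 (ln 2).
  have ln2 : 0 < ln 2 :> R by rewrite ln_gt0 // ltr1n.
  have eps0 : 0 < eps by rewrite mulr_gt0 // lt_min ltr01.
  have log_small : \forall n \near \oo, ln n%:R / (n%:R * pn n) < eps.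
    exact: cvgr_lt hlog _ eps0.
  have p_small : \forall n \near \oo, pn n < c by exact: cvgr_lt hpn0 _ c0.
  near=> n.
  have n3 : (3 <= n)%N by near: n; exact: nbhs_infty_ge.
  split=> //.
  have /andP[pn0 pn1] := hpn n n3.
  have n0 : 0 < n%:R :> R by rewrite ltr0n; apply: leq_trans n3.
  have np0 : 0 < n%:R * pn n by rewrite mulr_gt0.
  have lnn : ln n%:R <= eps * (n%:R * pn n).
    by rewrite -ler_pdivrMr // ltW //; near: n.
  have mean_n : ((beta3 * pn n)%:E <= inf_mean_prob (p n))%E by near: n.
  have local_n : ((beta1 * pn n)%:E <=
    inf_local_mean_prob (p n) (beta2 * n%:R * pn n))%E by near: n.
  have pnc : pn n <= c by rewrite ltW //; near: n.
  apply: (hc n (pn n) (p n) (ltnW n3) (hpn n n3) (hp01 n n3) (hpsym n n3)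
            mean_n local_n _ _ pnc).
  - have ln2n : ln 2 <= ln n%:R :> R.
      by rewrite ler_ln ?posrE // ler_nat ltnW.
    have := le_trans ln2n lnn.
    rewrite -[X in X <= _]mul1r -ler_pdivlMr // => /le_trans; apply.
    rewrite ler_pdivrMr // [leRHS]mulrAC ler_wpM2r ?(ltW np0) // /eps.
    by rewrite ler_wpM2l ?(ltW c0) // ge_min lexx orbT.
  - apply: le_trans lnn _; rewrite ler_wpM2r ?(ltW np0) //.
    by rewrite /eps ler_piMr ?(ltW c0) // ge_min lexx.
have probL n (X : pred nat) : (3 <= n)%N ->
    P n [set w | X (longest_path (G n w))] =
    (\sum_(A | X (longest_path (pair_graph A))) subset_weight (pair_prob (p n)) A)%:E.
  by move=> n3; exact: prob_longest_path (hG n n3) X.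
have expL n : (3 <= n)%N -> 'E_(P n)[L n]%E = (n%:R - expected_deficit (p n))%:E.
  by move=> n3; exact: expectation_path_length (hG n n3).
split.
- apply: filterS hD => n [n3 Dn].
  by rewrite expL // lee_fin lerD2l lerN2.
- move=> delta /andP[delta0 delta1]; apply: filterS hD => n [n3 Dn].
  have n0 : 0 < n%:R :> R by rewrite ltr0n; apply: leq_trans n3.
  set a := 2 * n%:R * _.
  have a0 : 0 < a by rewrite !mulr_gt0 // expR_gt0.
  rewrite (probL n (fun k => n%:R - a <= k%:R)) // lee_fin.
  apply: le_trans (deficit_markov (X := fun k => n%:R - a <= k%:R)
                     (hp01 n n3) a0 _); last first.
    by move=> k _; rewrite -ltNge => /ltW; lra.
  rewrite lerD2l lerN2 ler_pdivrMr //; apply: le_trans Dn _.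
  rewrite /a mulrCA ler_wpM2l ?mulr_ge0 ?(ltW n0) //.
  by rewrite -expRD ler_expR /x; lra.
move=> M hM hpM M1.
apply: filterS2 hD hpM => n [n3 Dn] pM.
have n0 : 0 < n%:R :> R by rewrite ltr0n; apply: leq_trans n3.
have powE : 2 * n%:R * expR (- x n) = 2 / n%:R `^ (M1 - 1).
  rewrite -mulrA; congr (_ * _).
  rewrite /powR gt_eqF // -expRN -{1}(lnK (x := n%:R)) ?posrE // -expRD.
  by congr expR; rewrite /x -[_ * n%:R * _]mulrA pM /M1; ring.
rewrite powE in Dn; split; first by rewrite expL // lee_fin lerD2l lerN2.
rewrite (_ : [set w | L n w = n%:R] = [set w | longest_path (G n w) == n]); last first.
  apply/seteqP; split=> w /=; first by move=> /eqP; rewrite /L /path_length eqr_nat.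
  by rewrite /L /path_length => /eqP ->.
rewrite (probL n (fun k => k == n)) // lee_fin.
(* A path that is not Hamiltonian misses at least one vertex. *)
apply: le_trans (deficit_markov (X := fun k => k == n) (hp01 n n3) ltr01 _).
  by rewrite divr1 lerD2l lerN2.
move=> k kn kNn; rewrite lerBrDl natr1 ler_nat.
by rewrite ltn_neqAle kNn.
Unshelve. all: by end_near.
Qed.
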